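(* Let $G$ be a Coxeter group, viewed as a poset under the (right) weak order $\le_{\mathrm{wk}}$, and let $v,w\in G$ with $v\le_{\mathrm{wk}} w$. The interval $[v,w]_{\mathrm{wk}}=\{u\in G: v\le_{\mathrm{wk}}u\le_{\mathrm{wk}}w\}$ is (1) always a lattice; (2) modular if and only if $v^{-1}w$ is fully commutative; (3) distributive if and only if $v^{-1}w$ is fully commutative; and (4) boolean if and only if $v^{-1}w$ is a product of commuting generators.
   Context: A Coxeter group $G$ comes with its generating set $S$ of involutions and relations $(st)^{m(s,t)}=1$. A reduced decomposition of $w\in G$ is an expression $w=s_1\cdots s_\ell$ with $s_i\in S$ and $\ell$ minimal. Right weak order: $v\le_{\mathrm{wk}}w$ if some reduced decomposition of $v$ is a prefix of a reduced decomposition of $w$. An element is fully commutative if any two of its reduced decompositions are related by a sequence of commutation moves only (replacing adjacent letters $st$ by $ts$ when $m(s,t)=2$). A product of commuting generators is a (possibly empty) product of elements of $S$ that pairwise commute. A poset is boolean if it is isomorphic to the poset of all subsets of a finite set, ordered by inclusion. *)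

(* Defs.v *)
From mathcomp Require Import all_boot all_order.
From Stdlib Require Import Relation_Operators.

Set Implicit Arguments.
Unset Strict Implicit.
Unset Printing Implicit Defensive.

Import Order.TTheory.
Local Open Scope group_scope.

(* The value 0 of [m s t] encodes m(s,t) = infinity: the relation
   [(st)^0 = 1] is then vacuous. *)
Definition coxeter_matrix (S : eqType) (m : S -> S -> nat) : Prop :=
  (forall s t, (m s t == 1%N) = (s == t)) /\ (forall s t, m s t = m t s).

Section Coxeter.
Variables (G : groupType) (S : eqType) (m : S -> S -> nat) (gen : S -> G).

Definition word_prod (a : seq S) : G := \prod_(s <- a) gen s.

(* G is the group presented by the generators S and the relations
   (st)^(m(s,t)) = 1: S generates G, the relations hold, and G has the
   universal property of the presentation. As m(s,s) = 1, the generators are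
   involutions, so words with positive letters reach all of G. Injectivity of
   [gen] is a consequence, so S can be regarded as a subset of G. *)
Definition coxeter_group : Prop :=
  [/\ coxeter_matrix m,
      forall g : G, exists a, word_prod a = g,
      forall s t, (gen s * gen t) ^+ m s t = 1 &
      forall (H : groupType) (f : S -> H),
        (forall s t, (f s * f t) ^+ m s t = 1) ->
        exists phi : {multiplicative G -> H}, forall s, phi (gen s) = f s].

Definition reduced_decomposition (a : seq S) (w : G) : Prop :=
  word_prod a = w /\ forall b, word_prod b = w -> size a <= size b.

Definition weak_le (v w : G) : Prop :=
  exists a b, [/\ reduced_decomposition a v, reduced_decomposition b w
                & prefix a b].

Definition weak_interval (v w : G) : Type :=
  {u : G | weak_le v u /\ weak_le u w}.

Definition weak_interval_le (v w : G) (x y : weak_interval v w) : Prop :=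
  weak_le (sval x) (sval y).

Definition commutation_move (a b : seq S) : Prop :=
  exists p s t q, [/\ m s t = 2, a = p ++ s :: t :: q & b = p ++ t :: s :: q].

Definition fully_commutative (w : G) : Prop :=
  forall a b, reduced_decomposition a w -> reduced_decomposition b w ->
    clos_refl_trans (seq S) commutation_move a b.

Definition product_of_commuting_generators (w : G) : Prop :=
  exists a, word_prod a = w /\
    {in a &, forall s t, commute (gen s) (gen t)}.

End Coxeter.

Definition poset_iso (A B : Type) (leA : A -> A -> Prop) (leB : B -> B -> Prop)
    : Prop :=
  exists f : A -> B, bijective f /\ forall x y, leA x y <-> leB (f x) (f y).

(* The properties below concern a bare relation [le] on a type; the library's
   ordered structures are reached through an order isomorphism. *)
Definition is_lattice (A : Type) (le : A -> A -> Prop) : Prop :=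
  exists (d : Order.disp_t) (L : latticeType d),
    poset_iso le (fun x y : L => (x <= y)%O).

Definition is_modular_lattice (A : Type) (le : A -> A -> Prop) : Prop :=
  exists (d : Order.disp_t) (L : latticeType d),
    poset_iso le (fun x y : L => (x <= y)%O) /\
    forall x y z : L,
      (x <= z)%O -> (x `|` (y `&` z) = (x `|` y) `&` z)%O.

Definition is_distributive_lattice (A : Type) (le : A -> A -> Prop) : Prop :=
  exists (d : Order.disp_t) (L : distrLatticeType d),
    poset_iso le (fun x y : L => (x <= y)%O).

Definition is_boolean (A : Type) (le : A -> A -> Prop) : Prop :=
  exists T : finType, poset_iso le (fun X Y : {set T} => X \subset Y).

(* Main.v *)
(** Translating by [v^-1] reduces to an interval [1,u]. The universal property
    yields two actions of [G]: one on signed reflections, which attaches to each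
    element its inversion set and gives the exchange condition, and the numbers
    game, which shows that the generators are distinct and that commuting
    distinct generators have [m s t = 2]. Joins in [1,u] are built by induction
    on the length, the join of two generators being the longest element of the
    dihedral group they generate; meets follow by the duality [x |-> u^-1 x].
    If [u] is fully commutative, inversion sets turn joins into unions and meets
    into intersections, so that [1,u] is distributive. If [1,u] is modular, it
    contains no polygon other than squares, so any two covers of an element come
    from commuting generators, and induction on the length shows that [u] is
    fully commutative. If [1,u] is boolean, [u] is the join of its atoms, which
    commute; conversely, below a product of distinct commuting generators an
    element is determined by the generators that it inverts. *)

Require Import Defs.
From Stdlib Require Import Relation_Operators.
From HB Require Import structures.
From mathcomp Require Import all_boot all_order all_algebra.
From mathcomp Require Import algC cyclotomic ring zify.
From mathcomp Require Import boolp.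

Set Implicit Arguments.
Unset Strict Implicit.
Unset Printing Implicit Defensive.

Import Order.TTheory.
Local Open Scope group_scope.

(** * Groups of bijections *)

Section Bijections.
Variable X : Type.

Record bijection := Bijection {
  bij_fun :> X -> X;
  bij_inv : X -> X;
  bij_funK : cancel bij_fun bij_inv;
  bij_invK : cancel bij_inv bij_fun }.

Lemma bijection_inj (f g : bijection) : bij_fun f =1 bij_fun g -> f = g.
Proof.
case: f g => [f f' fK f'K] [g g' gK g'K] /= /funext efg; subst g.
have ef : f' = g' by apply/funext => x; rewrite -{1}(g'K x) fK.
by subst g'; congr Bijection; apply: Prop_irrelevance.
Qed.

HB.instance Definition _ := gen_eqMixin bijection.
HB.instance Definition _ := gen_choiceMixin bijection.

Definition bij_one := @Bijection id id (fun=> erefl) (fun=> erefl).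

(* The product applies its left factor first, so that the letters of a word
   act in the order in which they are read. *)
Definition bij_mul (f g : bijection) :=
  Bijection (can_comp (bij_funK g) (bij_funK f))
            (can_comp (bij_invK f) (bij_invK g)).

Definition bij_opp (f : bijection) := Bijection (bij_invK f) (bij_funK f).

Fact bij_mulA : associative bij_mul.
Proof. by move=> f g h; apply: bijection_inj. Qed.

Fact bij_mul1 : left_id bij_one bij_mul.
Proof. by move=> f; apply: bijection_inj. Qed.

Fact bij_mulr1 : right_id bij_one bij_mul.
Proof. by move=> f; apply: bijection_inj. Qed.

Fact bij_mulV : left_inverse bij_one bij_opp bij_mul.
Proof. by move=> f; apply: bijection_inj => x; apply: bij_invK. Qed.

Fact bij_mulrV : right_inverse bij_one bij_opp bij_mul.
Proof. by move=> f; apply: bijection_inj => x; apply: bij_funK. Qed.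

HB.instance Definition _ :=
  isGroup.Build bijection bij_mulA bij_mul1 bij_mulr1 bij_mulV bij_mulrV.

Lemma bij_expE (f : bijection) n x : (f ^+ n) x = iter n f x.
Proof. by elim: n x => // n IHn x; rewrite expgS iterSr -IHn. Qed.

End Bijections.

(** * The numbers game *)

Section NumbersGame.
Import GRing.Theory Num.Theory.
Local Open Scope ring_scope.

Definition dihedral_root n : algC := sval (C_prim_root_exists (ltn0Sn n.*2.+1)).

Lemma dihedral_rootP n : (n.+1).*2.-primitive_root (dihedral_root n).
Proof. exact: (svalP (C_prim_root_exists (ltn0Sn n.*2.+1))). Qed.

(* For the root [exp(i pi / m)] this would be the usual [2 cos(pi / m)]; any
   primitive root of order [2 m] serves. The case [n = 0] stands for
   [m = infinity]. *)
Definition edge_weight n : algC :=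
  if n is p.+1 then dihedral_root p + (dihedral_root p)^-1 else 2.

Lemma dihedral_root_neq0 n : dihedral_root n != 0.
Proof.
have := prim_expr_order (dihedral_rootP n).
by apply: contra_eq_neq => ->; rewrite expr0n eq_sym oner_eq0.
Qed.

Lemma edge_weight1 : edge_weight 1 = -2.
Proof.
have z2 := prim_expr_order (dihedral_rootP 0).
have z1 := prim_order_dvd (dihedral_rootP 0) 1.
have /eqP : (dihedral_root 0) ^+ 2 = 1 by exact: z2.
rewrite sqrf_eq1 => /orP[/eqP z|/eqP z]; first by move: z1; rewrite /= z expr1n eqxx.
by rewrite /edge_weight z invrN1; ring.
Qed.

(** If [z + z^-1 = 0] then [z^4 = 1], so the order [2 n] of the root [z] divides 4. *)
Lemma edge_weight_eq0 n : edge_weight n = 0 -> n = 2%N \/ n = 1%N.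
Proof.
case: n => [/eqP|n]; first by rewrite pnatr_eq0.
move=> /= kn; have z0 := dihedral_root_neq0 n.
have : (dihedral_root n) ^+ 4 = 1.
  have -> : dihedral_root n ^+ 4 =
    1 + dihedral_root n * (dihedral_root n ^+ 2 - 1) * (dihedral_root n + (dihedral_root n)^-1)
    by field.
  by rewrite kn mulr0 addr0.
move/eqP; rewrite -(prim_order_dvd (dihedral_rootP n)) => /dvdn_leq.
by case: n {kn z0} => [|[|n]] //; [right | left | move=> /(_ isT)].
Qed.

Variables (S : eqType) (m : S -> S -> nat).
Hypothesis hm : coxeter_matrix m.

(** Firing [s] in the numbers game, a variant of the dual of the geometric representation. The value
    at [s] itself is negated, because [edge_weight 1] is -2. *)
Definition numbers_move s (c : S -> algC) r := c r + edge_weight (m s r) * c s.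

(** For [s != t] and [m s t] nonzero, [u] and [u'] are eigenfunctionals of the double move with
    eigenvalues [z^-2] and [z^2], whose [m s t]-th powers are 1. As [z^2] is not 1, [u] and [u']
    determine the values at [s] and [t]. *)
Lemma numbers_move_rel s t :
  iter (m s t) (fun c => numbers_move t (numbers_move s c)) =1 id.
Proof.
have [m1 mC] := hm.
have mm r : m r r = 1%N by apply/eqP; rewrite m1.
move=> c; have [<-|nst] := eqVneq s t.
  rewrite mm; apply/funext => r.
  by rewrite /= /numbers_move mm edge_weight1; ring.
case Em: (m s t) => [//|n].
have n0 : (0 < n)%N by case: n Em => // /eqP; rewrite m1 (negPf nst).
pose z := dihedral_root n; have z0 : z != 0 := dihedral_root_neq0 n.
have k_st : edge_weight (m s t) = z + z^-1 by rewrite Em.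
have k_ts : edge_weight (m t s) = z + z^-1 by rewrite mC Em.
have zn1 : z ^+ 2 != 1.
  rewrite -(prim_order_dvd (dihedral_rootP n)); apply/negP => /dvdn_leq.
  by move=> /(_ isT); move: n0; case: (n) => [|[|p]].
have zm : z ^+ 2 ^+ n.+1 = 1.
  by rewrite -exprM mul2n (prim_expr_order (dihedral_rootP n)).
pose F c := numbers_move t (numbers_move s c).
have D0 : z ^+ 2 - 1 != 0 by rewrite subr_eq0.
pose u c : algC := c s + z * c t; pose u' c : algC := c s + z^-1 * c t.
have uF c' : u (F c') = (z ^+ 2)^-1 * u c'.
  by rewrite /u /F /numbers_move !mm k_st k_ts edge_weight1; field.
have u'F c' : u' (F c') = z ^+ 2 * u' c'.
  by rewrite /u' /F /numbers_move !mm k_st k_ts edge_weight1; field.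
have uFn : u (iter n.+1 F c) = u c.
  suff -> j : u (iter j F c) = (z ^+ 2) ^- j * u c by rewrite zm invr1 mul1r.
  elim: j => [|j IHj]; first by rewrite invr1 mul1r.
  by rewrite iterS uF IHj mulrA -invfM -exprS.
have u'Fn : u' (iter n.+1 F c) = u' c.
  suff -> j : u' (iter j F c) = (z ^+ 2) ^+ j * u' c by rewrite zm mul1r.
  elim: j => [|j IHj]; first by rewrite mul1r.
  by rewrite iterS u'F IHj mulrA -exprS.
have ct : iter n.+1 F c t = c t.
  have e c' : c' t = z * (u c' - u' c') / (z ^+ 2 - 1) by rewrite /u /u'; field; apply/andP.
  by rewrite e uFn u'Fn -e.
have cs : iter n.+1 F c s = c s.
  have e c' : c' s = u c' - z * c' t by rewrite /u; ring.
  by rewrite e uFn ct -e.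
apply/funext => r.
(* Subtracting from [c r] a suitable combination of [c s] and [c t] gives a
   quantity fixed by both moves: the Gram matrix of the pair is invertible. *)
pose k := z + z^-1; pose a := edge_weight (m s r); pose b := edge_weight (m t r).
pose d := - ((z - z^-1) ^+ 2).
pose x := (- 2 * a - k * b) / d; pose y := (- 2 * b - k * a) / d.
pose v (c : S -> algC) := c r - x * c s - y * c t.
have vF c' : v (F c') = v c'.
  rewrite /v /F /numbers_move !mm k_st k_ts edge_weight1 -/a -/b /x /y /k /d.
  by field; apply/andP.
have vFn j : v (iter j F c) = v c by elim: j => // j; rewrite iterS vF.
have e c' : c' r = v c' + x * c' s + y * c' t by rewrite /v; ring.
by rewrite -/F [LHS]e vFn cs ct -e.
Qed.

Lemma numbers_moveE s c : numbers_move s c s = - c s.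
Proof.
case: hm => [m1 _]; have /eqP mss : m s s == 1%N by rewrite m1.
by rewrite /numbers_move mss edge_weight1; ring.
Qed.

End NumbersGame.

(** * Lattices up to isomorphism *)

Section OrderIsomorphisms.

Lemma poset_iso_sym (A B : Type) (leA : A -> A -> Prop) (leB : B -> B -> Prop) :
  poset_iso leA leB -> poset_iso leB leA.
Proof.
move=> [f [[g fK gK] fle]]; exists g; split; first by exists f.
by move=> x y; rewrite -{1}(gK x) -{1}(gK y) fle.
Qed.

Lemma poset_iso_trans (A B C : Type) (leA : A -> A -> Prop)
    (leB : B -> B -> Prop) (leC : C -> C -> Prop) :
  poset_iso leA leB -> poset_iso leB leC -> poset_iso leA leC.
Proof.
move=> [f [fbij fle]] [g [gbij gle]]; exists (g \o f).
by split=> [|x y]; [exact: bij_comp | rewrite fle gle].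
Qed.

Variables (A B : Type) (leA : A -> A -> Prop) (leB : B -> B -> Prop).
Hypothesis AB : poset_iso leA leB.

Lemma lattice_iso : is_lattice leB -> is_lattice leA.
Proof. by move=> [d [L BL]]; exists d, L; apply: poset_iso_trans BL. Qed.

Lemma modular_iso : is_modular_lattice leB -> is_modular_lattice leA.
Proof.
by move=> [d [L [BL mod]]]; exists d, L; split=> //; apply: poset_iso_trans BL.
Qed.

Lemma distributive_iso : is_distributive_lattice leB -> is_distributive_lattice leA.
Proof. by move=> [d [L BL]]; exists d, L; apply: poset_iso_trans BL. Qed.

Lemma boolean_iso : is_boolean leB -> is_boolean leA.
Proof. by move=> [T BT]; exists T; apply: poset_iso_trans BT. Qed.

End OrderIsomorphisms.

Lemma distributive_modular (A : Type) (leA : A -> A -> Prop) :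
  is_distributive_lattice leA -> is_modular_lattice leA.
Proof.
move=> [d [L AL]]; exists d, L; split=> // x y z xz.
by rewrite joinIr (join_r xz).
Qed.

Section BuildLattice.
Let disp := Order.Disp tt tt.
Variables (T : Type) (le : rel T) (meet join : T -> T -> T).
Hypotheses (le_refl : reflexive le) (le_anti : antisymmetric le)
  (le_trans : transitive le).
Hypothesis meetP : forall x y z, le x (meet y z) = le x y && le x z.
Hypothesis joinP : forall x y z, le (join x y) z = le x z && le y z.

Let TC : choiceType := HB.pack T (gen_eqMixin T) (gen_choiceMixin T).
Let TO : porderType disp :=
  HB.pack T TC (Order.Le_isPOrder.Build disp TC le_refl le_anti le_trans).
Let TL : latticeType disp :=
  HB.pack T TO (Order.POrder_MeetJoin_isLattice.Build disp TO meetP joinP).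

Lemma build_lattice : is_lattice le.
Proof. by exists _, TL; exists id; split=> //; exists id. Qed.

Lemma build_distributive :
    (forall x y z, meet (join x y) z = join (meet x z) (meet y z)) ->
  is_distributive_lattice le.
Proof.
move=> mUl; pose TD : distrLatticeType disp :=
  HB.pack T TL (Order.Lattice_Meet_isDistrLattice.Build disp TL mUl).
by exists _, TD; exists id; split=> //; exists id.
Qed.

End BuildLattice.

Lemma boolean_distributive (A : Type) (leA : A -> A -> Prop) :
  is_boolean leA -> is_distributive_lattice leA.
Proof.
move=> [T AT]; apply: (distributive_iso AT).
apply: (@build_distributive {set T} (fun X Y => X \subset Y) (@setI T) (@setU T)).
- exact: subxx.
- by move=> X Y XY; apply/eqP; rewrite eqEsubset.
- by move=> Y X Z; apply: subset_trans.
- by move=> X Y Z; rewrite subsetI.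
- by move=> X Y Z; rewrite subUset.
- exact: setIUl.
Qed.

(** * Inversions and length *)

Section Coxeter.
Variables (G : groupType) (S : eqType) (m : S -> S -> nat) (gen : S -> G).
Hypothesis hG : coxeter_group m gen.

Local Notation prodw := (word_prod gen).
Implicit Types (g h x y z u r : G) (s t : S) (a b c : seq S).

(** The universal property is applied to the bijections of [X]; the relation for [s = t] makes each
    [f s] an involution, hence a bijection. *)
Lemma coxeter_action (X : Type) (f : S -> X -> X) :
    (forall s t, iter (m s t) (fun x : X => f t (f s x)) =1 id) ->
  exists act : G -> X -> X,
    [/\ forall x : X, act 1 x = x, forall g h (x : X), act (g * h) x = act h (act g x) &
        forall s, act (gen s) =1 f s].
Proof.
case: hG => [[m1 _] _ _ univ] frel.
have fK s : involutive (f s).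
  by move=> x; move: (m1 s s) (frel s s x); rewrite eqxx => /eqP->.
pose F s := Bijection (fK s) (fK s).
have FR s t : (F s * F t) ^+ m s t = 1.
  by apply: bijection_inj => x; rewrite bij_expE; apply: frel.
have [phi phiE] := univ _ _ FR.
exists (fun g => bij_fun (phi g)); split=> [x | g h x | s x].
- suff -> : phi 1 = 1 by [].
  by apply: (mulgI (phi 1)); rewrite -gmulfM !mulg1.
- by rewrite gmulfM.
- by rewrite phiE.
Qed.

Lemma genV s : (gen s)^-1 = gen s.
Proof.
have [[m1 _] _ rel _] := hG; move: (m1 s s) (rel s s).
by rewrite eqxx => /eqP-> /mulg1_eq.
Qed.

Lemma gen2 s : gen s * gen s = 1. Proof. by rewrite -{1}genV mulVg. Qed.

Lemma genK s : involutive (fun x => gen s * x).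
Proof. by move=> x; rewrite mulgA gen2 mul1g. Qed.

Lemma prodw0 : prodw [::] = 1. Proof. exact: big_nil. Qed.

Lemma prodwS s a : prodw (s :: a) = gen s * prodw a. Proof. exact: big_cons. Qed.

Lemma prodw1 s : prodw [:: s] = gen s. Proof. by rewrite prodwS prodw0 mulg1. Qed.

Lemma prodwD a b : prodw (a ++ b) = prodw a * prodw b.
Proof. exact: big_cat. Qed.

Lemma prodwV a : (prodw a)^-1 = prodw (rev a).
Proof.
elim: a => [|s a IHa]; first by rewrite prodw0 invg1.
by rewrite prodwS invgM IHa genV rev_cons -cats1 prodwD prodw1.
Qed.

(** The action on signed reflections: conjugation by [gen s], with a change of sign at [gen s] only.
    It is defined on all of [G], not just on the reflections. *)
Definition inv_step s (q : G * bool) :=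
  (gen s * q.1 * gen s, (q.1 == gen s) (+) q.2).

(** With [p = gen s * gen t], after [n] rounds the sign at [x] has changed once for each [j < 2 n]
    such that [x = p^j * gen s]. For [n = m s t] the indices [j] and [n + j] give the same
    reflection, so the changes cancel in pairs. *)
Lemma inv_step_rel s t :
  iter (m s t) (fun q => inv_step t (inv_step s q)) =1 id.
Proof.
have [_ _ rel _] := hG.
have [p pE] : exists p, p = gen s * gen t by exists (gen s * gen t).
pose r (x : G) j := x == p ^+ j * gen s.
have pV : p^-1 = gen t * gen s by rewrite pE invgM !genV.
have genp j : gen s * p ^- j = p ^+ j * gen s.
  elim: j => [|j IHj]; first by rewrite invg1 mulg1 mul1g.
  by rewrite expgS invgM mulgA IHj pV -expgS expgSr pE -!mulgA.
have shift x j : r (p^-1 * x * p) j = r x j.+2.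
  have e : p^-1 * (p ^+ j.+2 * gen s) * p = p ^+ j * gen s.
    have psp : p * gen s * p = gen s by rewrite -{1}[p]expg1 -genp mulgVK.
    by rewrite expgS -!mulgA mulKg expgSr -{2}psp !mulgA.
  by rewrite /r -e (inj_eq (mulIg _)) (inj_eq (mulgI _)).
pose h q := inv_step t (inv_step s q).
have hE q : h q = (p^-1 * q.1 * p, (r q.1 0 (+) r q.1 1%N) (+) q.2).
  have -> : r q.1 0 = (q.1 == gen s) by rewrite /r mul1g.
  have -> : r q.1 1%N = (gen s * q.1 * gen s == gen t).
    rewrite /r expg1 pE -[RHS](inj_eq (mulgI (gen s))) -(inj_eq (mulIg (gen s))).
    by rewrite !mulgA gen2 mul1g -mulgA gen2 mulg1.
  by rewrite /h /inv_step /= pV pE !mulgA addbA [_ (+) (q.1 == _)]addbC.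
have hnE n q : iter n h q =
    (p ^- n * q.1 * p ^+ n, \big[addb/false]_(j < n.*2) r q.1 j (+) q.2).
  elim: n q => [|n IHn] q.
    by rewrite big_ord0 invg1 mul1g mulg1; case: q.
  rewrite iterSr IHn hE /= expgS invgM !mulgA; congr (_, _).
  rewrite !big_ord_recl addbA; congr (_ (+) _); rewrite addbC addbA; congr (_ (+) _).
  by apply: eq_bigr => i _; rewrite shift.
move=> q; rewrite [LHS]hnE pE rel invg1 mul1g mulg1 -addnn big_split_ord /=.
have per (i : 'I_(m s t)) : r q.1 (m s t + i) = r q.1 i.
  by rewrite /r expgnDr pE rel mul1g.
rewrite (eq_bigr _ (fun i _ => per i)) addbb; by case: q {per}.
Qed.

(** * Distinctness and commutation of generators *)

Section Faithful.
Import GRing.Theory Num.Theory.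
Let hm : coxeter_matrix m. Proof. by case: hG. Qed.

Lemma numbers_action :
  exists act : G -> (S -> algC) -> S -> algC,
    [/\ forall x : S -> algC, act 1 x = x,
        forall g h (x : S -> algC), act (g * h) x = act h (act g x) &
        forall s, act (gen s) =1 numbers_move m s].
Proof.
by apply: coxeter_action; apply: (numbers_move_rel hm).
Qed.

(** On the indicator function of [s], firing [s] turns the value at [s] into -1, while firing
    another vertex leaves it equal to 1. *)
Lemma gen_inj : injective gen.
Proof.
move=> s t est; apply/eqP/negPn/negP => nst.
have [act [_ _ actE]] := numbers_action.
pose c (r : S) : algC := (r == s)%:R%R.
have := (numbers_moveE hm) s c; rewrite -actE est actE /numbers_move /c.
rewrite eqxx eq_sym (negPf nst) mulr0 addr0 => /eqP.
by rewrite -subr_eq0 opprK -mulr2n pnatr_eq0.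
Qed.

(** From the indicator function of [t], firing [s] then [t] leaves the edge weight at [s]; the other
    order leaves its opposite. Hence the weight vanishes. *)
Lemma commute_gen s t : s != t -> commute (gen s) (gen t) -> m s t = 2.
Proof.
move=> nst st; have [[m1 mC] _ _ _] := hG.
have [act [_ actM actE]] := numbers_action.
pose c (r : S) : algC := (r == t)%:R%R.
have : act (gen s * gen t) c s = act (gen t * gen s) c s by rewrite st.
rewrite !actM !actE (numbers_moveE hm) {1}/numbers_move (numbers_moveE hm) /numbers_move /c.
rewrite eqxx (negPf nst) !(mulr0, mulr1, addr0, oppr0, add0r) mC => /eqP.
rewrite -addr_eq0 -mulr2n mulrn_eq0 /= => /eqP /edge_weight_eq0[] // /eqP.
by rewrite m1 (negPf nst).
Qed.

End Faithful.

(** The sign that [g] gives to [(x, false)]. The action commutes with changing the sign, so signs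
    add up along products, which is the cocycle identity. *)
Lemma inversions_exist : exists N : G -> G -> bool,
  [/\ forall x, N 1 x = false, forall s x, N (gen s) x = (x == gen s) &
      forall g h x, N (g * h) x = N g x (+) N h (g^-1 * x * g)].
Proof.
have [act [act1 actM actE]] := coxeter_action inv_step_rel.
have [_ word _ _] := hG.
exists (fun g x => (act g (x, false)).2); split=> [x | s x | g h x].
- by rewrite act1.
- by rewrite actE /inv_step /= addbF.
have actP k y e : act k (y, e) = (k^-1 * y * k, (act k (y, false)).2 (+) e).
  have [a <-] := word k; elim: a y e => [|s a IHa] y e.
    by rewrite prodw0 !act1 invg1 mulg1 mul1g addFb.
  rewrite prodwS !actM !actE /inv_step /= !(IHa _ (_ (+) _)) /= addbF -addbA.
  by rewrite invgM genV !mulgA.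
by rewrite actM (actP g) (surjective_pairing (act h _)) (actP h _ (_ (+) _)) /= !addbF addbC.
Qed.

(* [inversions g x] says that [x] is a left inversion of [g]: a reflection
   with [x * g] shorter than [g]. *)
Definition inversions : G -> G -> bool := projT1 (cid inversions_exist).
Local Notation N := inversions.

Lemma inv1 x : N 1 x = false.
Proof. by rewrite /N; case: cid => ? []. Qed.

Lemma inv_gen s x : N (gen s) x = (x == gen s).
Proof. by rewrite /N; case: cid => ? []. Qed.

Lemma invM g h x : N (g * h) x = N g x (+) N h (g^-1 * x * g).
Proof. by rewrite /N; case: cid => ? []. Qed.

(** * Length and the exchange condition *)

Fact len_exists g : exists n, `[< exists a, prodw a = g /\ size a = n >].
Proof. by have [_ /(_ g)[a ag] _ _] := hG; exists (size a); apply/asboolP; exists a. Qed.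

Definition len g := ex_minn (len_exists g).

(* The products in the goal may be built through different structures on [G],
   so that equal lengths are not syntactically equal. *)
Ltac len_lia :=
  intros; repeat match goal with H : context [len _] |- _ => revert H end;
  repeat match goal with |- context [len ?g] =>
    let l := fresh "l" in set l := (len g); move: l end; lia.

Lemma len_word g : exists a, prodw a = g /\ size a = len g.
Proof. by rewrite /len; case: ex_minnP => n /asboolP. Qed.

Lemma len_prodw a : len (prodw a) <= size a.
Proof.
by rewrite /len; case: ex_minnP => n _; apply; apply/asboolP; exists a.
Qed.

Lemma reducedE a g : reduced_decomposition gen a g <-> prodw a = g /\ size a = len g.
Proof.
split=> -[ag aP]; split=> //.
  by have [b [bg bl]] := len_word g; apply/eqP; rewrite eqn_leq -{2}ag len_prodw -bl aP.
by move=> b bg; rewrite aP -bg len_prodw.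
Qed.

Lemma len_eq0 g : len g = 0 -> g = 1.
Proof. by have [[|s a] [<- <-]] := len_word g; rewrite ?prodw0. Qed.

Lemma len1 : len 1 = 0.
Proof. by apply/eqP; rewrite -leqn0 -[1](prodw0) len_prodw. Qed.

Lemma lenM g h : len (g * h) <= len g + len h.
Proof.
have [[a [ag <-]] [b [bh <-]]] := (len_word g, len_word h).
by rewrite -ag -bh -prodwD -size_cat len_prodw.
Qed.

Lemma lenV g : len g^-1 = len g.
Proof.
suff le h : len h^-1 <= len h by apply/eqP; rewrite eqn_leq le -{1}[g]invgK le.
by have [a [<- <-]] := len_word h; rewrite prodwV -size_rev len_prodw.
Qed.

Lemma len_gen s : len (gen s) = 1%N.
Proof.
apply/eqP; rewrite eqn_leq -{1}prodw1 len_prodw lt0n; apply/eqP => /len_eq0 s1.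
by have := inv_gen s (gen s); rewrite {1}s1 inv1 eqxx.
Qed.

(** The strong exchange condition. The cocycle identity follows [x] through the word up to a letter
    whose conjugate is [x]; multiplying by [x] deletes that letter. *)
Lemma exchange a x : N (prodw a) x ->
  x * x = 1 /\ exists p s q, a = p ++ s :: q /\ x * prodw a = prodw (p ++ q).
Proof.
elim: a x => [|r a IHa] x; first by rewrite prodw0 inv1.
rewrite prodwS invM inv_gen; case: eqP => [-> _|_ /=].
  by split; [rewrite gen2 | exists [::], r, a; rewrite genK].
move=> /IHa[xx [p [s [q [-> e]]]]]; split.
  have -> : x = gen r * ((gen r)^-1 * x * gen r) * (gen r)^-1.
    by rewrite !mulgA mulgV mul1g mulgK.
  by move: (_ * x * _) xx => y yy; rewrite -!mulgA mulKg (mulgA y) yy mul1g mulgV.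
exists (r :: p), s, q; split=> //=; rewrite !prodwS -e genV.
by rewrite !mulgA gen2 mul1g.
Qed.

Lemma inv_len g x : N g x -> x * x = 1 /\ len (x * g) < len g.
Proof.
have [a [ag al]] := len_word g; rewrite -ag => /exchange[xx [p [s [q [ea ->]]]]].
by split=> //; rewrite ag -al ea (leq_ltn_trans (len_prodw _)) // !size_cat /= addnS.
Qed.

Lemma len_genM s g : len (gen s * g) = if N g (gen s) then (len g).-1 else (len g).+1.
Proof.
have le1 h : len (gen s * h) <= (len h).+1.
  by rewrite (leq_trans (lenM _ _)) // len_gen.
case: ifPn => [/inv_len[_ lt]|nN].
  by move: (le1 (gen s * g)); rewrite genK; len_lia.
(* Left multiplication by [gen s] toggles the sign at [gen s], so the first case applies to
   [gen s * g]. *)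
have : N (gen s * g) (gen s) by rewrite invM inv_gen eqxx genV // gen2 // mul1g.
by move=> /inv_len[_]; rewrite genK; have := le1 g; len_lia.
Qed.

(** * The weak order *)

(** The weak order as additivity of lengths, which makes it a boolean relation; [weak_leE] links it
    to prefixes. *)
Definition wle x y := len y == len x + len (x^-1 * y).

Lemma wlexx x : wle x x.
Proof. by rewrite /wle mulVg len1 addn0. Qed.

Lemma wle1g x : wle 1 x.
Proof. by rewrite /wle len1 invg1 mul1g. Qed.

Lemma wle_len x y : wle x y -> len x <= len y.
Proof. by move=> /eqP->; rewrite leq_addr. Qed.

Lemma wle_len_eq x y : wle x y -> len y <= len x -> x = y.
Proof.
move=> /eqP-> h; have /len_eq0 xy : len (x^-1 * y) = 0 by len_lia.
by rewrite -[x]mulg1 -xy mulVKg.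
Qed.

Lemma wle_anti x y : wle x y -> wle y x -> x = y.
Proof. by move=> xy /wle_len; apply: wle_len_eq. Qed.

Lemma wle_trans y x z : wle x y -> wle y z -> wle x z.
Proof.
move=> /eqP xy /eqP yz; rewrite /wle eqn_leq -{1}[z](mulVKg x) lenM yz xy.
by rewrite -addnA leq_add2l -[x^-1 * z](mulKg (y^-1 * x)) invgM invgK !mulgA mulgK -mulgA lenM.
Qed.

Lemma wleM x y : wle x (x * y) = (len (x * y) == len x + len y).
Proof. by rewrite /wle mulKg. Qed.

Lemma wle_gen s g : wle (gen s) g = N g (gen s).
Proof.
rewrite /wle len_gen genV // len_genM; case: ifP => [/inv_len[_ lt]|_]; last by apply/eqP; len_lia.
by apply/eqP; len_lia.
Qed.

Lemma wle_cancel z x y : wle z x -> wle z y -> wle (z^-1 * x) (z^-1 * y) = wle x y.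
Proof.
move=> /eqP zx /eqP zy; rewrite /wle zx zy -addnA eqn_add2l.
by rewrite invgM invgK mulgA mulgK.
Qed.

Lemma wle_mulP z u x : wle z u -> wle x (z^-1 * u) ->
  [/\ wle z (z * x), wle (z * x) u & len (z * x) = len z + len x].
Proof.
move=> /eqP zu /eqP xu.
have := lenM z x; have := lenM (z * x) ((z * x)^-1 * u); rewrite mulVKg zu xu.
rewrite wleM {1}/wle zu xu invgM -!mulgA => h1 h2.
have e : len (z * x) = len z + len x by len_lia.
by rewrite e addnA !eqxx.
Qed.

Lemma weak_leE x y : weak_le gen x y <-> wle x y.
Proof.
split=> [[a [b [/reducedE[ax al] /reducedE[<- bl]]]] /prefixP[c eb]|xy].
  subst b; rewrite prodwD ax wleM eqn_leq lenM -al /=.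
  by have := len_prodw c; move: bl; rewrite prodwD ax size_cat; len_lia.
have [a [ax al]] := len_word x; have [c [cx cl]] := len_word (x^-1 * y).
exists a, (a ++ c); split; first exact/reducedE; last exact: prefix_prefix.
by apply/reducedE; rewrite prodwD ax cx mulVKg size_cat al cl (eqP xy).
Qed.

(** The two inversion sets are disjoint: a common [r] would shorten both factors of
    [x * y = (r * x) * (x^-1 * r * x * y)]. *)
Lemma inv_add x y r : len (x * y) = len x + len y ->
  N (x * y) r = N x r || N y (x^-1 * r * x).
Proof.
move=> e; rewrite invM; case: (boolP (N x r)) => //= /inv_len[rr lx].
apply/negP => /inv_len[_]; rewrite -!mulgA => ly.
have := lenM (r * x) (x^-1 * (r * (x * y))).
by rewrite -mulgA mulVKg mulgA rr mul1g e; len_lia.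
Qed.

Lemma inv_wle x y r : wle x y -> N x r -> N y r.
Proof. by move=> /eqP xy nx; rewrite -[y](mulVKg x) inv_add ?nx // mulVKg. Qed.

(** By the cocycle identity [x^-1 * y] has no inversions, whereas the first letter of a nonempty
    reduced word is one. *)
Lemma inversions_inj x y : N x =1 N y -> x = y.
Proof.
move=> exy; suff /len_eq0 e : len (x^-1 * y) = 0 by rewrite -[y](mulVKg x) e mulg1.
have [[|s c] [cg cl]] := len_word (x^-1 * y); first by rewrite -cl.
have : N (x^-1 * y) (gen s) = false.
  have := invM x (x^-1 * y) (x * gen s * x^-1).
  by rewrite mulVKg -exy !mulgA mulVg mul1g mulgVK; case: (N x _); case: (N _ _).
have := len_genM s (x^-1 * y) => + nN; rewrite nN -{1}cg prodwS genK -cl /=.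
by have := len_prodw c; lia.
Qed.

Lemma cat_eq_cons (T : Type) (c w p q : seq T) (r : T) : c ++ w = p ++ r :: q ->
  (exists q0, c = p ++ r :: q0 /\ q = q0 ++ w) \/
  (exists p0, p = c ++ p0 /\ w = p0 ++ r :: q).
Proof.
elim: c p => [|x c IHc] [|y p] /=; try by [right; exists [::] | right; exists (y :: p)].
  by move=> [-> <-]; left; exists c.
by move=> [-> /IHc[[q0 [-> ->]]|[p0 [-> ->]]]]; [left; exists q0 | right; exists p0].
Qed.

(** * Dihedral parabolic subgroups *)

Fixpoint alt s t n : seq S := if n is k.+1 then s :: alt t s k else [::].

Lemma size_alt s t n : size (alt s t n) = n.
Proof. by elim: n s t => //= n IHn s t; rewrite IHn. Qed.

Lemma alt_rcons s t n : alt s t n.+1 = rcons (alt s t n) (if odd n then t else s).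
Proof. by elim: n s t => // n IHn s t; rewrite /= -/(alt t s n.+1) IHn /= if_neg. Qed.

Definition reduced a := len (prodw a) == size a.

Lemma reduced_cat a b : reduced (a ++ b) -> reduced a /\ reduced b.
Proof.
rewrite /reduced prodwD size_cat => /eqP e; have := lenM (prodw a) (prodw b).
by have := len_prodw a; have := len_prodw b; split; apply/eqP; len_lia.
Qed.

Lemma reduced_alt s t n k : k <= n -> reduced (alt s t n) -> reduced (alt s t k).
Proof.
move=> /subnKC <-; elim: (n - k)%N => [|j IHj]; first by rewrite addn0.
by rewrite addnS alt_rcons -cats1 => /reduced_cat[/IHj].
Qed.

Section Dihedral.
Variables s t : S.
Local Notation dih := (all (mem [:: s; t])).

(** [g'] is a shortest element of the coset of [g] modulo the subgroup generated by [s] and [t]. *)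
Lemma coset_min g : exists c g', [/\ dih c, prodw c * g' = g &
  forall c', dih c' -> len g' <= len (prodw c' * g')].
Proof.
have ex : exists n, `[< exists c, dih c /\ len (prodw c * g) = n >].
  by exists (len (prodw [::] * g)); apply/asboolP; exists [::].
case: (ex_minnP ex) => n /asboolP[c [cd <-]] min.
exists (rev c), (prodw c * g); split; first by rewrite all_rev.
  by rewrite -prodwV mulKg.
move=> c' c'd; apply: min; apply/asboolP; exists (c' ++ c).
by rewrite all_cat c'd cd prodwD mulgA.
Qed.

(** The exchanged letter lies in [c]: deleting one from a reduced word of [g'] would give a shorter
    element of the same coset. *)
Lemma coset_exchange g' c p :
    (forall c', dih c' -> len g' <= len (prodw c' * g')) -> dih c -> p \in [:: s; t] ->
    N (prodw c * g') (gen p) ->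
  exists c', [/\ dih c', (size c').+1 = size c & gen p * prodw c = prodw c'].
Proof.
move=> min cd pd; have [w [gw wl]] := len_word g'.
rewrite -gw -prodwD => /exchange[_ [q [r [q' [e0]]]]]; case: (cat_eq_cons e0).
  move=> [q0 [ec ->]]; rewrite catA [RHS]prodwD prodwD mulgA => /mulIg e.
  exists (q ++ q0); split=> //; last by rewrite ec !size_cat /= addnS.
  by move: cd; rewrite ec !all_cat /= => /and3P[-> _ ->].
move=> [p0 [-> ew]]; rewrite -catA !prodwD => e.
have /min : dih (rev c ++ p :: c) by rewrite all_cat all_rev /= pd cd.
rewrite prodwD prodwS -prodwV -!mulgA -{2}gw e.
rewrite mulKg -prodwD -wl ew; have := len_prodw (p0 ++ q'); rewrite !size_cat /=.
by len_lia.
Qed.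

Lemma coset_len g' c :
    (forall c', dih c' -> len g' <= len (prodw c' * g')) -> dih c ->
    (forall c', dih c' -> prodw c' = prodw c -> size c <= size c') ->
  len (prodw c * g') = size c + len g'.
Proof.
move=> min; elim: c => [|p c IHc] /=; first by rewrite prodw0 mul1g.
move=> /andP[pd cd] cmin; have lc : len (prodw c * g') = size c + len g'.
  apply: IHc => // c' c'd e; have := cmin (p :: c'); rewrite /= pd c'd !prodwS e.
  exact.
rewrite prodwS -mulgA len_genM; case: ifP => [|_]; last by rewrite -/len lc.
move=> /(coset_exchange min cd pd)[c' [c'd lc' e]].
by have := cmin c' c'd; rewrite prodwS e => /(_ erefl); lia.
Qed.

End Dihedral.

Lemma dih_alt s t c : all (mem [:: s; t]) c -> reduced (s :: c) ->
  s :: c = alt s t (size c).+1.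
Proof.
elim: c s t => // p c IHc s t /=; rewrite !inE => /andP[/orP[]/eqP-> cd] red.
  move: red; rewrite /reduced !prodwS genK => /eqP /=.
  by have := len_prodw c; len_lia.
congr (_ :: _); apply: IHc; last by have [] := @reduced_cat [:: s] _ red.
by apply: sub_all cd => x; rewrite !inE orbC.
Qed.

(* The common value is the component of [g] in the dihedral parabolic subgroup
   generated by [s] and [t]. *)
Lemma common_alt s t g : wle (gen s) g -> wle (gen t) g ->
  exists n, [/\ prodw (alt s t n) = prodw (alt t s n), reduced (alt s t n),
                0 < n & wle (prodw (alt s t n)) g].
Proof.
rewrite !wle_gen => Ns Nt; have [c0 [g' [c0d eg min]]] := coset_min s t g.
have ex : exists n, `[< exists c, [/\ all (mem [:: s; t]) c, prodw c = prodw c0 & size c = n] >].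
  by exists (size c0); apply/asboolP; exists c0.
case: (ex_minnP ex) => n /asboolP[c [cd ec sc]] cmin.
have {}cmin c' : all (mem [:: s; t]) c' -> prodw c' = prodw c -> size c <= size c'.
  by move=> c'd e; rewrite sc; apply: cmin; apply/asboolP; exists c'; rewrite e ec.
have lc := coset_len min cd cmin; rewrite -ec in eg.
have redc : len (prodw c) = size c.
  by have := lenM (prodw c) g'; have := len_prodw c; len_lia.
have first p : p \in [:: s; t] -> N g (gen p) ->
    exists c', [/\ all (mem [:: s; t]) c', (size c').+1 = size c & prodw (p :: c') = prodw c].
  move=> pd; rewrite -eg => /(coset_exchange min cd pd)[c' [c'd sc' e]].
  by exists c'; rewrite prodwS -e genK.
have [cs [csd ls es]] := first s (mem_head _ _) Ns.
have [ct [ctd lt et]] := first t (mem_last s [:: t]) Nt.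
have as_ : s :: cs = alt s t (size c).
  by rewrite -ls; apply: dih_alt => //; rewrite /reduced es redc /= ls.
have at_ : t :: ct = alt t s (size c).
  rewrite -lt; apply: dih_alt; last by rewrite /reduced et redc /= lt.
  by apply: sub_all ctd => x; rewrite !inE orbC.
exists (size c); rewrite /reduced -as_ -at_ es et redc /= ls -ls; split=> //.
by rewrite -eg wleM lc redc.
Qed.

(** In an alternating word of length [n + 1], replacing the first [n] letters by the other
    alternating word creates a repeated letter, which cancels. *)
Lemma alt_unique s t n k : prodw (alt s t n) = prodw (alt t s n) -> 0 < n ->
  reduced (alt s t k) -> k <= n.
Proof.
case: n => // n e _ red; rewrite leqNgt; apply/negP => lt.
have := reduced_alt lt red; rewrite /reduced size_alt alt_rcons -cats1 prodwD e.
rewrite alt_rcons -cats1 prodwD prodw1 prodw1 -mulgA /= if_neg gen2 mulg1.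
by have := len_prodw (alt t s n); rewrite size_alt; len_lia.
Qed.

(** By [alt_unique] the length found by [common_alt] is the same for all common upper bounds, so one
    alternating word lies below all of them. *)
Lemma gen_join s t g : s != t -> wle (gen s) g -> wle (gen t) g ->
  exists n, [/\ prodw (alt s t n) = prodw (alt t s n), reduced (alt s t n), 1 < n,
    wle (prodw (alt s t n)) g & forall g', wle (gen s) g' -> wle (gen t) g' ->
    wle (prodw (alt s t n)) g'].
Proof.
move=> nst sb tb; have [n [e red n0 nb]] := common_alt sb tb.
exists n; split=> //.
  case: n e n0 {red nb} => [|[|n]] // + _; rewrite !prodw1 => /gen_inj /eqP.
  by rewrite (negPf nst).
move=> g' sb' tb'; have [k [e' red' k0 kb']] := common_alt sb' tb'.
suff -> : n = k by [].
by apply/eqP; rewrite eqn_leq (alt_unique e' k0 red) (alt_unique e n0 red').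
Qed.

Lemma alt_commute s t n : commute (gen s) (gen t) -> reduced (alt s t n) -> n <= 2.
Proof.
move=> st; apply: alt_unique => //=; rewrite !prodwS prodw0 !mulg1; exact: st.
Qed.

Lemma first_letter x : x != 1 -> exists s, wle (gen s) x.
Proof.
have [[|s c] [<- l]] := len_word x; first by rewrite prodw0 eqxx.
move=> _; exists s; rewrite /wle len_gen prodwS genV genK -prodwS -l /= add1n eqSS.
have [_ /eqP-> //] : reduced [:: s] /\ reduced c.
by apply: reduced_cat; rewrite /reduced -l.
Qed.

Lemma wle_reduced a b : reduced (a ++ b) -> wle (prodw a) (prodw (a ++ b)).
Proof.
move=> red; have [/eqP la /eqP lb] := reduced_cat red.
by rewrite prodwD wleM -prodwD (eqP red) size_cat la lb.
Qed.

(** * Rigid elements, joins and meets *)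

(* By a theorem on partially commutative monoids this characterizes the fully
   commutative elements; unlike the definition, it visibly passes to factors. *)
Definition rigid g := forall a b p q, prodw a = g -> prodw b = g ->
  reduced a -> reduced b -> m p q != 2 ->
  filter (mem [:: p; q]) a = filter (mem [:: p; q]) b.

(** A commutation move exchanges letters with [m s t = 2]; at most one of them survives the filter,
    so the filtered word does not change. *)
Lemma fully_commutative_rigid g : fully_commutative m gen g -> rigid g.
Proof.
move=> fc a b p q ag bg ra rb mpq; have [[m1 mC] _ _ _] := hG.
have {ag bg ra rb} : clos_refl_trans (seq S) (commutation_move m) a b.
  apply: fc; apply/reducedE; first by rewrite ag -(eqP ra) ag.
  by rewrite bg -(eqP rb) bg.
elim=> // [{}a {}b [c [s [t [d [mst -> ->]]]]]|{}a c {}b _ -> _ -> //].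
rewrite !filter_cat /= !inE; congr (_ ++ _).
have nst : s != t by rewrite -m1 mst.
have ab : ~~ ((s == p) || (s == q)) || ~~ ((t == p) || (t == q)).
  rewrite -negb_and; apply: contra mpq => /andP[sP tP]; move: sP tP mst nst.
  by move=> /orP[]/eqP-> /orP[]/eqP->; rewrite ?eqxx // mC => ->.
by move: ab; case: ifP; case: ifP.
Qed.

Lemma rigidS s g : wle (gen s) g -> rigid g -> rigid (gen s * g).
Proof.
rewrite wle_gen => Ng rg a b p q ag bg ra rb mpq.
have lg : len g = (len (gen s * g)).+1.
  by have [_ lt] := inv_len Ng; move: lt; rewrite !len_genM Ng; case: (len g).
have red c : prodw c = gen s * g -> reduced c -> reduced (s :: c).
  by move=> cg; rewrite /reduced prodwS cg genK lg => /eqP->.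
have eg c : prodw c = gen s * g -> prodw (s :: c) = g by move=> cg; rewrite prodwS cg genK.
have := rg _ _ p q (eg _ ag) (eg _ bg) (red _ ag ra) (red _ bg rb) mpq.
by rewrite /=; case: ifP => // _ [].
Qed.

Lemma reduced_rev a : reduced (rev a) = reduced a.
Proof. by rewrite /reduced -prodwV lenV size_rev. Qed.

Lemma rigidV g : rigid g -> rigid g^-1.
Proof.
move=> rg a b p q ag bg ra rb mpq; apply: (inv_inj revK); rewrite -!filter_rev.
by apply: rg; rewrite ?reduced_rev // -prodwV ?ag ?bg invgK.
Qed.

Lemma commute_m2 s t : m s t = 2 -> commute (gen s) (gen t).
Proof.
have [_ _ rel _] := hG; move=> mst; have := rel s t.
by rewrite mst expg2 => /mulg1_eq; rewrite invgM !genV.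
Qed.

(** If [m s t] were not 2, extending both alternating words to reduced words of [g] would give
    projections to [s] and [t] with different first letters. *)
Lemma rigid_gen_join s t n g : s != t -> rigid g ->
  prodw (alt s t n) = prodw (alt t s n) -> reduced (alt s t n) -> 1 < n ->
  wle (prodw (alt s t n)) g -> m s t = 2 /\ n = 2.
Proof.
move=> nst rg e red n1 jg.
have mst : m s t = 2.
  apply/eqP/negPn/negP => mst; have [c [cw lc]] := len_word ((prodw (alt s t n))^-1 * g).
  have eg : prodw (alt s t n ++ c) = g by rewrite prodwD cw mulVKg.
  have eg' : prodw (alt t s n ++ c) = g by rewrite prodwD -e cw mulVKg.
  have l : len g = n + size c by rewrite (eqP jg) (eqP red) size_alt lc.
  have := rg _ _ s t eg eg'; rewrite /reduced eg eg' !size_cat !size_alt l eqxx.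
  move=> /(_ isT isT mst); case: (n) n1 => //= k _; rewrite !inE !eqxx orbT /=.
  by move=> [est _]; rewrite est eqxx in nst.
split=> //; apply/eqP; rewrite eqn_leq n1 andbT.
exact: alt_commute (commute_m2 mst) red.
Qed.

(** The statement on inversions is bundled with the join so that one induction proves both. The
    bound [g] ranges over all of [G], not only below [u]. *)
Definition is_join u x y z := [/\ wle z u, wle x z, wle y z,
  forall g, wle x g -> wle y g -> wle z g &
  rigid u -> forall r, N z r = N x r || N y r].

Lemma join_above s u : wle (gen s) u ->
    (forall x y, wle x (gen s * u) -> wle y (gen s * u) ->
       exists z, is_join (gen s * u) x y z) ->
  forall x y, wle (gen s) x -> wle (gen s) y -> wle x u -> wle y u ->
    exists z, is_join u x y z.
Proof.
move=> su joins x y sx sy xu yu.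
have [||z [zu xz yz lub Nz]] := joins (gen s * x) (gen s * y).
- by rewrite -[gen s]genV wle_cancel.
- by rewrite -[gen s]genV wle_cancel.
have zu' : wle z ((gen s)^-1 * u) by rewrite genV.
have [sz szu lz] := wle_mulP su zu'.
have above x' : wle (gen s) x' -> wle (gen s * x') z -> wle x' (gen s * z).
  by move=> sx'; rewrite -(@wle_cancel (gen s) x') // genV genK.
exists (gen s * z); split=> // [||g xg yg|ru r]; first exact: above.
- exact: above.
- have sg := wle_trans sx xg.
  rewrite -(@wle_cancel (gen s)) // genV genK; apply: lub; rewrite -[gen s]genV wle_cancel //.
have Nadd x' : wle (gen s) x' ->
    N x' r = N (gen s) r || N (gen s * x') ((gen s)^-1 * r * gen s).
  by move=> sx'; rewrite -{1}[x'](genK s) inv_add // genK len_gen (eqP sx') genV len_gen.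
rewrite (Nadd _ sz) (Nadd _ sx) (Nadd _ sy) genK Nz; last exact: rigidS.
by case: (N (gen s) r).
Qed.

(** Elements above a common generator are handled by [join_above]. If [x] and [y] start with
    distinct [s] and [t], let [j] be the join of these generators: the joins of [x] with [j], of [y]
    with [j], and of the two results are all taken above a common generator. *)
Lemma weak_join u x y : wle x u -> wle y u -> exists z, is_join u x y z.
Proof.
elim: {u}(len u) {-2}u (leqnn (len u)) x y => [|n IHn] u lu x y xu yu.
  have u1 : u = 1 by apply: len_eq0; apply/eqP; rewrite -leqn0.
  have le1 x' : wle x' u -> x' = 1.
    by move=> /wle_len; rewrite u1 len1 leqn0 => /eqP /len_eq0.
  rewrite (le1 x xu) (le1 y yu) u1.
  exists 1; split; rewrite ?wlexx //.
  by move=> _ r; rewrite inv1.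
have {}IHn s x' y' : wle (gen s) x' -> wle (gen s) y' -> wle x' u -> wle y' u ->
    exists z, is_join u x' y' z.
  move=> sx sy xu' yu'; have su := wle_trans sx xu'.
  apply: (@join_above s) => // x'' y''; apply: IHn.
  by rewrite len_genM -wle_gen su; move: lu; case: (len u).
have [x1|/first_letter[s sx]] := eqVneq x 1.
  by exists y; split; rewrite ?x1 ?wle1g ?wlexx // => _ r; rewrite inv1.
have [y1|/first_letter[t ty]] := eqVneq y 1.
  by exists x; split; rewrite ?y1 ?wle1g ?wlexx // => _ r; rewrite inv1 orbF.
have [st|nst] := eqVneq s t; first by apply: (IHn s); rewrite // st.
have su := wle_trans sx xu; have tu := wle_trans ty yu.
have [k [ek red k1 ju jlub]] := gen_join nst su tu.
move: (ek) (red) ju jlub; set j := prodw (alt s t k) => ej _ ju jlub.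
have sj : wle (gen s) j.
  by rewrite -[gen s]prodw1 /j; case: (k) k1 red => // k' _ /(@wle_reduced [:: s]).
have tj : wle (gen t) j.
  have red' : reduced (alt t s k) by rewrite /reduced -ek (eqP red) !size_alt.
  by rewrite -[gen t]prodw1 ej; case: (k) k1 red' => // k' _ /(@wle_reduced [:: t]).
have [x' [x'u xx' jx' xlub Nx]] := IHn s x j sx sj xu ju.
have [y' [y'u yy' jy' ylub Ny]] := IHn t y j ty tj yu ju.
have [z [zu xz yz zlub Nz]] := IHn s x' y' (wle_trans sx xx') (wle_trans sj jy') x'u y'u.
exists z; split=> // [||g xg yg|ru r].
- exact: wle_trans xx' xz.
- exact: wle_trans yy' yz.
- have jg : wle j g by apply: jlub; [exact: wle_trans xg | exact: wle_trans yg].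
  by apply: zlub; [apply: xlub | apply: ylub].
rewrite Nz // Nx // Ny //.
have [mst k2] := rigid_gen_join nst ru ek red k1 ju.
(* Here [j = gen s * gen t] inverts only the two generators, which [x] and [y] invert already. *)
have Nj : N j r -> N x r || N y r.
  rewrite /j k2 /= !prodwS prodw0 mulg1 invM !inv_gen.
  have -> : ((gen s)^-1 * r * gen s == gen t) = (r == gen t).
    rewrite -[RHS](inj_eq (mulgI (gen s)^-1)) -[RHS](inj_eq (mulIg (gen s))).
    by rewrite -mulgA -[_ * gen t * _]mulgA -(commute_m2 mst) mulKg mulgA.
  have [->|_ /= /eqP->] := eqVneq r (gen s); first by rewrite -wle_gen sx.
  by rewrite -(wle_gen t y) ty orbT.
by case: (N j r) Nj => [/(_ isT)|_]; [case: (N x r) => //= -> | rewrite !orbF].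
Qed.

Lemma wle_dual1 u x : wle x u -> wle (u^-1 * x) u^-1.
Proof.
move=> /eqP xu; rewrite /wle lenV -[len (u^-1 * x)]lenV !invgM !invgK -mulgA mulgV mulg1 lenV xu.
by rewrite addnC.
Qed.

Lemma wle_dual u x y : wle x u -> wle y u -> wle (u^-1 * y) (u^-1 * x) = wle x y.
Proof.
move=> /eqP xu /eqP yu; rewrite /wle -[len (u^-1 * x)]lenV -[len (u^-1 * y)]lenV.
have -> : (u^-1 * y)^-1 * (u^-1 * x) = y^-1 * x by rewrite invgM invgK -mulgA mulVKg.
rewrite -[len (y^-1 * x)]lenV !invgM !invgK.
by apply/eqP/eqP; len_lia.
Qed.

Definition is_meet u x y z := [/\ wle z u, wle z x, wle z y,
  forall g, wle g x -> wle g y -> wle g z &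
  rigid u -> forall r, N z r = N x r && N y r].

(* The map [x |-> u^-1 * x] reverses the order and complements inversion sets. *)
Lemma weak_meet u x y : wle x u -> wle y u -> exists z, is_meet u x y z.
Proof.
move=> xu yu; have [z' [zu xz yz lub Nz]] := weak_join (wle_dual1 xu) (wle_dual1 yu).
pose z := u * z'; have ez : z' = u^-1 * z by rewrite mulKg.
have {}zu : wle z u by have := wle_dual1 zu; rewrite !invgK.
rewrite ez !wle_dual // in xz yz; exists z; split=> // [g gx gy|ru r].
  have gu := wle_trans gx xu; rewrite -(@wle_dual u) // -ez.
  by apply: lub; rewrite wle_dual.
have Nd x' : N x' r = N u r (+) N (u^-1 * x') (u^-1 * r * u) by rewrite -invM mulVKg.
have Nu x' : wle x' u -> N x' r ==> N u r by move=> x'u; apply/implyP/inv_wle.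
move: (Nu x xu) (Nu y yu) (Nu z zu) (Nz (rigidV ru) (u^-1 * r * u)).
rewrite !(Nd x) !(Nd y) !(Nd z) -ez => + + + ->.
by case: (N u r); case: (N (u^-1 * x) _); case: (N (u^-1 * y) _).
Qed.

(** * Intervals *)

Definition interval u := {x : G | wle x u}.
Definition interval_le u (p q : interval u) := wle (val p) (val q).

Lemma weak_interval_iso v w : weak_le gen v w ->
  poset_iso (@weak_interval_le G S gen v w) (@interval_le (v^-1 * w)).
Proof.
move=> /weak_leE vw.
have fP (p : weak_interval gen v w) : wle (v^-1 * sval p) (v^-1 * w).
  by case: p => x /= [/weak_leE vx /weak_leE xw]; rewrite wle_cancel.
have gP (q : interval (v^-1 * w)) : weak_le gen v (v * val q) /\ weak_le gen (v * val q) w.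
  by have [vy yw _] := wle_mulP vw (valP q); split; apply/weak_leE.
exists (fun p => Sub (v^-1 * sval p) (fP p)); split; last first.
  move=> p q; have [/weak_leE vp _] := svalP p; have [/weak_leE vq _] := svalP q.
  rewrite /interval_le /= wle_cancel //.
  exact: weak_leE.
exists (fun q => exist _ (v * val q) (gP q)) => [[p pP] | q]; last first.
  by apply: val_inj; rewrite /= mulKg.
by apply: eq_exist; rewrite /= mulVKg.
Qed.

Section Interval.
Variable u : G.
Implicit Types X Y Z : interval u.

Lemma interval_join X Y : exists Z, is_join u (val X) (val Y) (val Z).
Proof.
have [z zJ] := weak_join (valP X) (valP Y); have [zu _ _ _ _] := zJ.
by exists (Sub z zu).
Qed.

Lemma interval_meet X Y : exists Z, is_meet u (val X) (val Y) (val Z).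
Proof.
have [z zM] := weak_meet (valP X) (valP Y); have [zu _ _ _ _] := zM.
by exists (Sub z zu).
Qed.

Let join X Y := projT1 (cid (interval_join X Y)).
Let meet X Y := projT1 (cid (interval_meet X Y)).

Let interval_le_refl : reflexive (@interval_le u).
Proof. by move=> X; apply: wlexx. Qed.

Let interval_le_anti : antisymmetric (@interval_le u).
Proof. by move=> X Y /andP[XY YX]; apply: val_inj; apply: wle_anti. Qed.

Let interval_le_trans : transitive (@interval_le u).
Proof. by move=> Y X Z; apply: wle_trans. Qed.

Let interval_joinP X Y Z :
  interval_le (join X Y) Z = interval_le X Z && interval_le Y Z.
Proof.
rewrite /join; case: cid => J /= [_ XJ YJ lub _]; apply/idP/andP=> [JZ | [XZ YZ]].
  by split; [exact: wle_trans XJ JZ | exact: wle_trans YJ JZ].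
exact: lub.
Qed.

Let interval_meetP X Y Z :
  interval_le X (meet Y Z) = interval_le X Y && interval_le X Z.
Proof.
rewrite /meet; case: cid => M /= [_ MY MZ glb _]; apply/idP/andP=> [XM | [XY XZ]].
  by split; [exact: wle_trans XM MY | exact: wle_trans XM MZ].
exact: glb.
Qed.

Lemma interval_lattice : is_lattice (@interval_le u).
Proof.
exact: build_lattice interval_le_refl interval_le_anti interval_le_trans
  interval_meetP interval_joinP.
Qed.

Lemma rigid_distributive : rigid u -> is_distributive_lattice (@interval_le u).
Proof.
move=> ru; apply: (build_distributive interval_le_refl interval_le_anti
  interval_le_trans interval_meetP interval_joinP) => X Y Z.
have NJ A B r : N (val (join A B)) r = N (val A) r || N (val B) r.
  by rewrite /join; case: cid => J /= [_ _ _ _ ->].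
have NM A B r : N (val (meet A B)) r = N (val A) r && N (val B) r.
  by rewrite /meet; case: cid => M /= [_ _ _ _ ->].
by apply: val_inj; apply: inversions_inj => r; rewrite !(NJ, NM) andb_orl.
Qed.

End Interval.

(** * From modularity to full commutativity *)

Definition commuting_covers u := forall x s t, s != t -> wle x (x * gen s) ->
  wle x (x * gen t) -> wle (x * gen s) u -> wle (x * gen t) u -> m s t = 2.

(* Otherwise the interval from [x] to the join of [x * gen s] and [x * gen t]
   is a polygon with more than four vertices, which contains a pentagon. *)
Lemma modular_commuting_covers u :
  is_modular_lattice (@interval_le u) -> commuting_covers u.
Proof.
move=> [d [L [[f [[g fK gK] fle]] mod]]] x s t nst xs xt su tu.
have xu := wle_trans xs su.
have cancelx y z : wle x y -> wle x z -> wle (x^-1 * y) (x^-1 * z) = wle y z.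
  exact: wle_cancel.
have sb : wle (gen s) (x^-1 * u) by rewrite -(mulKg x (gen s)) cancelx.
have tb : wle (gen t) (x^-1 * u) by rewrite -(mulKg x (gen t)) cancelx.
have [n [ej red n1 jb jlub]] := gen_join nst sb tb.
have [n2|n2] := eqVneq n 2.
  apply: commute_gen => //; move: ej; rewrite n2 /= !prodwS prodw0 !mulg1.
  exact.
have {n1 n2} [k nk] : exists k, n = k.+3.
  by case: n n1 n2 {ej red jb jlub} => [|[|[|k]]] //; exists k.
(* [c0] is the join without its last letter. As [n >= 3] it is strictly above [gen s], so [x],
   [x * gen s], [x * c0], [x * gen t] and the join form a pentagon. *)
pose c0 := prodw (alt s t k.+2).
have redc : reduced (alt s t k.+2) by apply: reduced_alt red; rewrite nk.
have c0j : wle c0 (prodw (alt s t n)).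
  by move: red; rewrite nk alt_rcons -cats1 => /wle_reduced.
have c0u := wle_trans c0j jb.
have sc0 : wle (gen s) c0 by rewrite -[gen s]prodw1; apply: (@wle_reduced [:: s]).
have [xc cu _] := wle_mulP xu c0u.
pose X : interval u := Sub x xu; pose A : interval u := Sub (x * gen s) su.
pose B : interval u := Sub (x * gen t) tu; pose C : interval u := Sub (x * c0) cu.
have le1 Y Z : interval_le Y Z = (f Y <= f Z)%O by apply/idP/idP => /fle.
have AC : (f A <= f C)%O by rewrite -le1 /interval_le /= -cancelx // !mulKg.
have := mod _ (f B) _ AC; have -> : ((f A `|` f B) `&` f C)%O = f C.
  apply: meet_r; rewrite -[(_ `|` _)%O]gK -le1.
  have AE : interval_le A (g (f A `|` f B)%O) by rewrite le1 gK leUl.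
  have BE : interval_le B (g (f A `|` f B)%O) by rewrite le1 gK leUr.
  have xE := wle_trans xs AE.
  rewrite /interval_le /= -cancelx // mulKg; apply: wle_trans c0j _.
  by apply: jlub; rewrite -[gen _](mulKg x) cancelx.
suff BCA : (f B `&` f C <= f A)%O.
  rewrite (join_l BCA) => /(can_inj fK) /(congr1 val) /= /mulgI e.
  by have := eqP redc; rewrite -/c0 -e len_gen size_alt.
rewrite -[(_ `&` _)%O]gK -le1; set D := g _.
have DB : interval_le D B by rewrite le1 gK leIl.
have DC : interval_le D C by rewrite le1 gK leIr.
have XD : interval_le X D.
  by rewrite le1 gK lexI -!le1 /interval_le /= xt xc.
(* As [B] covers [x], the meet [D] is [x] or [B]; in the latter case [c0] would lie above both
   generators, hence above the longer join. *)
have [lD|lD] := leqP (len (val D)) (len x).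
  by have := wle_len_eq XD lD; rewrite /interval_le => <-.
have DBe : val D = x * gen t.
  apply: wle_len_eq DB _; rewrite (eqP xt) mulKg len_gen addn1; exact: lD.
have tc0 : wle (gen t) c0.
  by move: DC; rewrite /interval_le DBe /= -cancelx // !mulKg.
have := wle_len (jlub _ sc0 tc0); rewrite (eqP red) (eqP redc) !size_alt nk.
by rewrite ltnn.
Qed.

Lemma commuting_coversS s u : wle (gen s) u -> commuting_covers u ->
  commuting_covers (gen s * u).
Proof.
move=> su cu x p q npq xp xq pu qu; have xu := wle_trans xp pu.
rewrite -(genV s) in xu pu qu.
have [_ _ lx] := wle_mulP su xu.
have [_ spu lp] := wle_mulP su pu; have [_ squ lq] := wle_mulP su qu.
apply: (cu (gen s * x) p q) => //.
- by rewrite wleM -mulgA lp lx (eqP xp) mulKg addnA.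
- by rewrite wleM -mulgA lq lx (eqP xq) mulKg addnA.
- by rewrite -mulgA.
- by rewrite -mulgA.
Qed.

Local Notation comm_equiv := (clos_refl_trans (seq S) (commutation_move m)).

Lemma comm_equiv_cons s a b : comm_equiv a b -> comm_equiv (s :: a) (s :: b).
Proof.
elim=> [{}a {}b [p [x [y [q [mxy -> ->]]]]]|{}a|{}a c {}b _ ac _ cb].
- by apply: rt_step; exists (s :: p), x, y, q.
- exact: rt_refl.
- exact: rt_trans ac cb.
Qed.

(** Words with distinct first letters [s] and [t] are linked through [s :: t :: c] and
    [t :: s :: c]; the outer links keep the first letter and follow by induction. *)
Lemma commuting_covers_fc u : commuting_covers u -> fully_commutative m gen u.
Proof.
elim: {u}(len u) {-2}u (erefl (len u)) => [|n IHn] u lu cu a b.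
  move=> /reducedE[_ la] /reducedE[_ lb]; move: la lb; rewrite lu.
  by move=> /size0nil-> /size0nil->; apply: rt_refl.
move=> /reducedE[ea la] /reducedE[eb lb].
case: a ea la => [|s a] ea la; first by rewrite lu in la.
case: b eb lb => [|t b] eb lb; first by rewrite lu in lb.
have tail (r : S) c : prodw (r :: c) = u -> size (r :: c) = len u ->
    [/\ wle (gen r) u, len (gen r * u) = n & reduced_decomposition gen c (gen r * u)].
  move=> ec lc; have red : reduced (r :: c) by rewrite /reduced ec lc.
  have ru : wle (gen r) u.
    by rewrite -ec -{1}[gen r]prodw1; apply: (@wle_reduced [:: r]).
  have lru : len (gen r * u) = n by rewrite len_genM -wle_gen ru lu.
  split=> //; apply/reducedE; rewrite lru -ec prodwS genK; split=> //.
  by move: lc; rewrite lu => -[].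
have [su ls ra] := tail s a ea la; have [tu lt rb] := tail t b eb lb.
have IH (r : S) c c' : wle (gen r) u -> len (gen r * u) = n ->
    reduced_decomposition gen c (gen r * u) ->
    reduced_decomposition gen c' (gen r * u) -> comm_equiv (r :: c) (r :: c').
  move=> ru lr rc rc'; apply: comm_equiv_cons; apply: (IHn (gen r * u)) => //.
  exact: commuting_coversS.
have [est|nst] := eqVneq s t; first by subst t; apply: (IH s).
have mst : m s t = 2 by apply: (cu 1 s t) => //; rewrite ?mul1g ?wle1g.
have st := commute_m2 mst.
have [k [_ redk k1 ku _]] := gen_join nst su tu.
have k2 : k = 2 by apply/eqP; rewrite eqn_leq k1 (alt_commute st redk).
subst k; have [c [cw lc]] := len_word ((prodw (alt s t 2))^-1 * u).
have ec : prodw (s :: t :: c) = u by rewrite -[s :: _]/(alt s t 2 ++ c) prodwD cw mulVKg.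
have ec' : prodw (t :: s :: c) = u by rewrite -ec !prodwS !mulgA st.
have lc' : (size c).+2 = len u by rewrite (eqP ku) (eqP redk) lc.
have [_ _ rs] := tail s (t :: c) ec lc'; have [_ _ rt] := tail t (s :: c) ec' lc'.
apply: rt_trans (IH s a (t :: c) su ls ra rs) _.
apply: rt_trans (IH t (s :: c) b tu lt rt rb).
by apply: rt_step; exists [::], s, t, c.
Qed.

(** * Products of commuting generators and boolean intervals *)

Definition commuting a := {in a &, forall s t, commute (gen s) (gen t)}.

Lemma commuting_sub a b : {subset a <= b} -> commuting b -> commuting a.
Proof. by move=> ab cb s t /ab sb /ab; apply: cb. Qed.

Lemma prodw_rem s a : commuting a -> s \in a -> prodw a = gen s * prodw (rem s a).
Proof.
elim: a => // t a IHa ca /=; rewrite inE; case: eqVneq => [->|nst /= sa].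
  by rewrite prodwS.
rewrite !prodwS IHa //; first by rewrite !mulgA (ca t s) // !inE ?eqxx ?sa ?orbT.
by apply: commuting_sub ca => x xa; rewrite inE xa orbT.
Qed.

Lemma prodw_perm a b : commuting a -> perm_eq a b -> prodw a = prodw b.
Proof.
elim: a b => [|s a IHa] b ca; first by rewrite perm_sym => /perm_nilP->.
move=> ab; have sb : s \in b by rewrite -(perm_mem ab) mem_head.
rewrite (@prodw_rem s b) //; last by apply: commuting_sub ca => x; rewrite (perm_mem ab).
rewrite prodwS (IHa (rem s b)) //.
  by apply: commuting_sub ca => x xa; rewrite inE xa orbT.
by rewrite -(perm_cons s) (perm_trans ab) // perm_to_rem.
Qed.

Lemma commuting_uniq a : commuting a ->
  exists b, [/\ uniq b, commuting b & prodw b = prodw a].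
Proof.
move=> ca; suff [b [ub sub eb]] : exists b, [/\ uniq b, {subset b <= a} & prodw b = prodw a].
  by exists b; split=> //; apply: commuting_sub ca.
elim: a ca => [|s a IHa] ca; first by exists [::].
have [|b [ub sub eb]] := IHa; first by apply: commuting_sub ca => x xa; rewrite inE xa orbT.
have sub' : {subset b <= s :: a} by move=> x /sub xa; rewrite inE xa orbT.
have [sb|nsb] := boolP (s \in b); last first.
  exists (s :: b); split=> [|x|]; rewrite ?prodwS ?eb //= ?nsb //.
  by rewrite inE => /orP[/eqP->|/sub']; rewrite ?mem_head.
exists (rem s b); split; first exact: rem_uniq.
  by move=> x /mem_rem /sub'.
by rewrite prodwS -eb (prodw_rem _ sb) ?genK //; apply: commuting_sub ca.
Qed.

(** Conjugation by a letter fixes the others, and distinct letters do not cancel in the cocycle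
    identity. *)
Lemma inv_commuting a r : uniq a -> commuting a ->
  N (prodw a) r = (r \in map gen a).
Proof.
elim: a r => [|s a IHa] r /=; first by rewrite prodw0 inv1.
move=> /andP[sa ua] ca; have ca' : commuting a.
  by apply: commuting_sub ca => x xa; rewrite inE xa orbT.
rewrite prodwS invM inv_gen IHa // in_cons.
have -> : ((gen s)^-1 * r * gen s \in map gen a) = (r \in map gen a).
  apply/mapP/mapP => -[t ta e]; exists t => //.
    have st : commute (gen s) (gen t) by apply: ca; rewrite ?mem_head // inE ta orbT.
    by apply: (mulgI (gen s)^-1); apply: (mulIg (gen s)); rewrite e -mulgA -st mulKg.
  have st : commute (gen s) (gen t) by apply: ca; rewrite ?mem_head // inE ta orbT.
  by rewrite e -mulgA -st mulKg.
by case: eqVneq => // ->; rewrite (mem_map gen_inj) (negPf sa).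
Qed.

Lemma reduced_commuting a : uniq a -> commuting a -> reduced a.
Proof.
elim: a => [|s a IHa] /=; first by rewrite /reduced prodw0 len1.
move=> /andP[sa ua] ca; have ca' : commuting a.
  by apply: commuting_sub ca => x xa; rewrite inE xa orbT.
rewrite /reduced prodwS len_genM inv_commuting // (mem_map gen_inj) (negPf sa).
by rewrite (eqP (IHa _ _)).
Qed.

(** Once [s] is removed from [u], another letter [t] stays below, since the join of the two
    generators is [gen s * gen t]. *)
Lemma commuting_wle a u : uniq a -> commuting a -> {in a, forall s, wle (gen s) u} ->
  wle (prodw a) u.
Proof.
elim: a u => [|s a IHa] u /=; first by rewrite prodw0 wle1g.
move=> /andP[sa ua] ca au; have ca' : commuting a.
  by apply: commuting_sub ca => x xa; rewrite inE xa orbT.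
have su : wle (gen s) u by apply: au; rewrite mem_head.
have : wle (prodw a) ((gen s)^-1 * u).
  apply: IHa => // t ta; have nst : s != t by apply: contraNneq sa => ->.
  have st : commute (gen s) (gen t) by apply: ca; rewrite ?mem_head // inE ta orbT.
  have tu : wle (gen t) u by apply: au; rewrite inE ta orbT.
  have [k [_ red k1 ju _]] := gen_join nst su tu.
  have k2 : k = 2 by apply/eqP; rewrite eqn_leq k1 (alt_commute st red).
  move: red ju; rewrite k2 => /(@wle_reduced [:: s]) /=; rewrite prodw1 => sj ju.
  by rewrite -(wle_cancel sj) // prodwS mulKg prodw1 in ju *.
by move=> /(wle_mulP su)[_ + _]; rewrite prodwS.
Qed.

Lemma boolean_product u : is_boolean (@interval_le u) ->
  product_of_commuting_generators gen u.
Proof.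
move=> hb; have cov : commuting_covers u.
  by apply: modular_commuting_covers; apply: distributive_modular; apply: boolean_distributive.
case: hb => T [f [[g fK gK] fle]].
have le1 Y Z : interval_le Y Z = (f Y \subset f Z) by apply/idP/idP => /fle.
pose E : interval u := Sub 1 (wle1g u).
have fE : f E = set0.
  by apply/eqP; rewrite -subset0 -(gK set0) -le1; apply: wle1g.
(* A first letter of the element attached to a singleton corresponds to a nonempty subset of it,
   hence to the singleton. *)
have atom i : exists s, val (g [set i]) = gen s.
  have ne1 : val (g [set i]) != 1.
    apply/eqP => e; have : g [set i] = E by apply: val_inj.
    by move/(congr1 f)/eqP; rewrite gK fE -cards_eq0 cards1.
  have [s si] := first_letter ne1; exists s.
  have su : wle (gen s) u := wle_trans si (valP (g [set i])).
  pose A : interval u := Sub (gen s) su.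
  have : f A \subset [set i] by rewrite -[[set i]]gK -le1.
  rewrite subset1 => /orP[/eqP fA|/eqP fA]; first by rewrite -fA fK.
  have : A = E by apply: (can_inj fK); rewrite fE.
  by move/(congr1 val)/(congr1 len) => /=; rewrite len_gen len1.
have [h hE] := choice atom.
have hu i : wle (gen (h i)) u by rewrite -hE; exact: (valP (g [set i])).
have h_inj : injective h.
  by move=> i j e; apply: set1_inj; apply: (can_inj gK); apply: val_inj; rewrite !hE e.
pose a := map h (enum T).
have ua : uniq a by rewrite map_inj_uniq ?enum_uniq.
have ca : commuting a.
  move=> _ _ /mapP[i _ ->] /mapP[j _ ->]; have [->//|nij] := eqVneq i j.
  apply: commute_m2; apply: (cov 1); rewrite ?mul1g ?wle1g //.
  by apply: contra_neq nij => /h_inj.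
exists a; split=> //.
have au : wle (prodw a) u by apply: commuting_wle => // _ /mapP[i _ ->].
apply: (wle_anti au).
pose U : interval u := exist _ u (wlexx u); pose A : interval u := Sub (prodw a) au.
(* The product lies above every atom, so it corresponds to the full set, as the top element does. *)
rewrite -[wle _ _]/(interval_le U A) le1; apply: subset_trans (subsetT _) _.
apply/subsetP => i _; rewrite -sub1set -[[set i]]gK -le1 /interval_le hE /=.
by rewrite wle_gen inv_commuting // map_f // map_f // mem_enum.
Qed.

Lemma product_boolean u : product_of_commuting_generators gen u ->
  is_boolean (@interval_le u).
Proof.
move=> [a [<- /commuting_uniq[b [ub cb <-]]]]; set v := prodw b.
pose w (P : pred S) := prodw (filter P b).
have cf P : commuting (filter P b).
  by apply: commuting_sub cb => x; rewrite mem_filter => /andP[].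
have Nw P s : N (w P) (gen s) = P s && (s \in b).
  by rewrite inv_commuting ?filter_uniq // (mem_map gen_inj) mem_filter.
have wle_w (P Q : pred S) : {in b, forall s, P s -> Q s} -> wle (w P) (w Q).
  move=> PQ.
  (* Moving the letters that satisfy [P] to the front makes a word for [w P] a prefix of a reduced
     word for [w Q]. *)
  have e := permEl (perm_filterC P (filter Q b)).
  have eP : filter P (filter Q b) = filter P b.
    rewrite -filter_predI; apply: eq_in_filter => s sb /=.
    by case: (boolP (P s)) => // /(PQ s sb) ->.
  have ce : commuting (filter P (filter Q b) ++ filter (predC P) (filter Q b)).
    by apply: commuting_sub (cf Q) => x; rewrite (perm_mem e).
  rewrite /w -(prodw_perm ce e) -eP.
  apply: wle_reduced; apply: reduced_commuting; first by rewrite (perm_uniq e) filter_uniq.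
  exact: ce.
have vE : v = w predT by rewrite /w filter_predT.
(* The positions in [b] serve as the finite ground set, since [S] need not be finite. *)
pose tn := tnth (in_tuple b).
have tn_inj : injective tn by apply/tuple_uniqP.
have tnb i : tn i \in b by rewrite /tn mem_tnth.
pose P (A : {set 'I_(size b)}) : pred S := fun s => s \in [seq tn i | i in A].
have Pv A : wle (w (P A)) v by rewrite vE; apply: wle_w.
exists 'I_(size b), (fun X => [set i | N (val X) (gen (tn i))]).
(* An element below [v] inverts only letters of [b], so it has the same inversions as the product of
   the letters that it inverts. *)
have wK (X : interval v) : w (P [set i | N (val X) (gen (tn i))]) = val X.
  apply: inversions_inj => r; rewrite inv_commuting ?filter_uniq //.
  apply/mapP/idP => [[s + ->]|NX].
    by rewrite mem_filter => /andP[/imageP[i + ->] _]; rewrite inE.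
  have := inv_wle (valP X) NX; rewrite /v inv_commuting // => /mapP[s sb er].
  exists s => //; rewrite mem_filter sb andbT.
  have [i ei] := tnthP (in_tuple b) s sb.
  by apply/imageP; exists i => //; rewrite inE /tn -ei -er.
split.
  exists (fun A => exist _ (w (P A)) (Pv A)) => [X|A]; first exact/val_inj/wK.
  by apply/setP => i; rewrite inE /= Nw tnb andbT /P mem_image.
move=> X Y; split=> [XY|/subsetP XY].
  by apply/subsetP => i; rewrite !inE; apply: inv_wle.
rewrite /interval_le -(wK X) -(wK Y); apply: wle_w => s _ /imageP[i iX ->].
by rewrite /P mem_image // XY.
Qed.

End Coxeter.

Theorem corollary4p4 (G : groupType) (S : eqType) (m : S -> S -> nat)
    (gen : S -> G) (hG : coxeter_group m gen) (v w : G)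
    (hvw : weak_le gen v w) :
  let le := @weak_interval_le G S gen v w in
  [/\ is_lattice le,
      is_modular_lattice le <-> fully_commutative m gen (v^-1 * w),
      is_distributive_lattice le <-> fully_commutative m gen (v^-1 * w) &
      is_boolean le <-> product_of_commuting_generators gen (v^-1 * w)].
Proof.
have iso := weak_interval_iso hG hvw; have osi := poset_iso_sym iso; move=> le.
have fcD : fully_commutative m gen (v^-1 * w) -> is_distributive_lattice le.
  by move=> fc; apply/(distributive_iso iso)/rigid_distributive/fully_commutative_rigid.
have modF : is_modular_lattice le -> fully_commutative m gen (v^-1 * w).
  by move=> /(modular_iso osi) /modular_commuting_covers /commuting_covers_fc.
split; [| split | split | split] => //.
- exact: lattice_iso iso (interval_lattice hG _).
- by move=> /fcD /distributive_modular.
- by move=> /distributive_modular /modF.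
- by move=> /(boolean_iso osi) /boolean_product.
- by move=> /(product_boolean hG) /(boolean_iso iso).
Qed.
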